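(* Every piecewise testable set over a finite alphabet $\Sigma$ can be accepted by an end-decisive MM-QFA with bounded error.
   Context: A piecewise testable set over $\Sigma$ is a finite Boolean combination (unions, intersections, complements) of sets of the form $\Sigma^*z_1\Sigma^*z_2\Sigma^*\cdots\Sigma^*z_n\Sigma^*$ with $z_1,\dots,z_n\in\Sigma$. A measure-many quantum finite automaton (MM-QFA) over $\Sigma$ is a tuple $(Q,\Sigma,\{U_\sigma\}_{\sigma\in\Sigma\cup\{\$\}},q_0,Q_{acc},Q_{rej})$ with $Q$ finite indexing an orthonormal basis of $\mathbb{C}^Q$, end-marker $\$\notin\Sigma$, unitary $U_\sigma$, initial state $q_0$, and $Q$ partitioned into $Q_{acc},Q_{rej},Q_{non}$ with orthogonal projections $P_{acc},P_{rej},P_{non}$. On input $x$ it processes $x\$$ maintaining $(\psi,p_{acc},p_{rej})$, initially $(|q_0\rangle,0,0)$; on reading $\sigma$: $\psi'=U_\sigma\psi$, $p_{acc}\mathrel{+}=\|P_{acc}\psi'\|^2$, $p_{rej}\mathrel{+}=\|P_{rej}\psi'\|^2$, $\psi\leftarrow P_{non}\psi'$; the acceptance probability $p(x)$ is the final $p_{acc}$. It is end-decisive if $P_{acc}\psi'=0$ after reading every non-end-marker symbol, on every input. It accepts $L$ with bounded error if for some $\lambda$ and $\epsilon>0$, $p(x)>\lambda+\epsilon$ for $x\in L$ and $p(x)<\lambda-\epsilon$ for $x\notin L$. *)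

(* Defs.v *)
From mathcomp Require Import all_boot all_algebra.
From mathcomp Require Import reals.
From mathcomp.real_closed Require Import complex.
Set Implicit Arguments. Unset Strict Implicit. Unset Printing Implicit Defensive.
Import GRing.Theory Num.Theory.
Local Open Scope ring_scope.

(* x belongs to  Sigma^star z_1 Sigma^star z_2 Sigma^star ... Sigma^star z_n Sigma^star
   where z = [:: z_1; ...; z_n] (n = 0 gives Sigma^star). *)
Fixpoint in_shuffle_ideal (Sigma : Type) (z x : seq Sigma) : Prop :=
  match z with
  | [::] => True
  | a :: z' => exists u v, x = u ++ a :: v /\ in_shuffle_ideal z' v
  end.

Inductive pt_expr (Sigma : Type) : Type :=
  | PTAtom of seq Sigma
  | PTUnion of pt_expr Sigma & pt_expr Sigma
  | PTInter of pt_expr Sigma & pt_expr Sigma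
  | PTCompl of pt_expr Sigma.

Fixpoint pt_sem (Sigma : Type) (e : pt_expr Sigma) (x : seq Sigma) : Prop :=
  match e with
  | PTAtom z => in_shuffle_ideal z x
  | PTUnion e1 e2 => pt_sem e1 x \/ pt_sem e2 x
  | PTInter e1 e2 => pt_sem e1 x /\ pt_sem e2 x
  | PTCompl e1 => ~ pt_sem e1 x
  end.

Definition piecewise_testable (Sigma : finType) (L : seq Sigma -> Prop) : Prop :=
  exists e : pt_expr Sigma, forall x, L x <-> pt_sem e x.

(* Q = 'I_n; input symbols are [option Sigma], with None the end-marker $.
   Q is partitioned into Q_acc, Q_rej (disjoint) and Q_non = the rest. *)
Record mmqfa (R : realType) (Sigma : finType) := MMQFA {
  mm_n : nat;
  mm_U : option Sigma -> 'M[R[i]]_mm_n;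
  mm_q0 : 'I_mm_n;
  mm_acc : {set 'I_mm_n};
  mm_rej : {set 'I_mm_n}
}.

Definition unitary (R : realType) (n : nat) (U : 'M[R[i]]_n) : Prop :=
  U *m (map_mx Num.conj U)^T = 1%:M /\ (map_mx Num.conj U)^T *m U = 1%:M.

Definition proj (R : realType) (n : nat) (S : {set 'I_n}) : 'M[R[i]]_n :=
  \matrix_(i, j) (if (i == j) && (i \in S) then 1 else 0).

Definition norm2 (R : realType) (n : nat) (v : 'cV[R[i]]_n) : R[i] :=
  \sum_i `|v i 0| ^+ 2.

Definition well_formed (R : realType) (Sigma : finType) (M : mmqfa R Sigma) : Prop :=
  [disjoint mm_acc M & mm_rej M] /\ forall s, unitary (mm_U M s).

Section Run.
Variables (R : realType) (Sigma : finType) (M : mmqfa R Sigma).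
Local Notation n := (mm_n M).

Definition P_acc := @proj R n (mm_acc M).
Definition P_rej := @proj R n (mm_rej M).
Definition P_non := @proj R n (~: (mm_acc M :|: mm_rej M)).

Definition init_vec : 'cV[R[i]]_n := \col_i (if i == mm_q0 M then 1 else 0).

Definition mm_step (c : 'cV[R[i]]_n * R[i] * R[i]) (s : option Sigma)
  : 'cV[R[i]]_n * R[i] * R[i] :=
  let: (psi, pa, pr) := c in
  let psi' := mm_U M s *m psi in
  (P_non *m psi', pa + norm2 (P_acc *m psi'), pr + norm2 (P_rej *m psi')).

Definition mm_run (w : seq (option Sigma)) :=
  foldl mm_step (init_vec, 0, 0) w.

Definition accept_prob (x : seq Sigma) : R[i] :=
  (mm_run (rcons (map Some x) None)).1.2.

Definition state_after (w : seq Sigma) : 'cV[R[i]]_n :=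
  (mm_run (map Some w)).1.1.

Definition end_decisive : Prop :=
  forall (w : seq Sigma) (s : Sigma),
    P_acc *m (mm_U M (Some s) *m state_after w) = 0.

Definition accepts_bounded (L : seq Sigma -> Prop) : Prop :=
  exists (lam eps : R), 0 < eps /\
    forall x, (L x -> ((lam + eps)%:C)%C < accept_prob x) /\
              (~ L x -> accept_prob x < ((lam - eps)%:C)%C).
End Run.

(* Main.v *)
(* Amplitudes obtained by compressing real orthogonal matrices to a subspace realize lazy random walks driven by permutations, since (I + V)/2 is a compression of an orthogonal matrix whenever V is a permutation matrix.
   For a word z of length n, let the walk on {0, ..., n} have, for each letter a, the permutation that cycles every maximal run of transitions i -> i+1 with z_(i+1) = a. Starting from 0, the support after reading w is {0, ..., k}, where k is the length of the longest prefix of z embedded in w. Every step is doubly stochastic, so the least positive mass drops only when k grows, by at most one half, however long w is. Hence the mass at n is 0 if z is not a subword of w and at least 2^-n otherwise.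
   The realizable functions contain these masses and are closed under f -> 1 - f and under products (tensor product of walks); so 1 - (1 - f)^m approximates uniformly the indicator of an atom, and the indicators of Boolean combinations follow.
   A final orthogonal matrix, dilating the projection onto the indicator vector of a set A of states, turns the mass f of A into the acceptance probability f^2 / #|A|. *)
Require Import Defs.
From mathcomp Require Import all_boot all_order all_fingroup all_algebra.
From mathcomp Require Import reals.
From mathcomp.real_closed Require Import complex.
From mathcomp Require Import ring lra zify.
Set Implicit Arguments. Unset Strict Implicit. Unset Printing Implicit Defensive.
Import Order.TTheory GRing.Theory Num.Theory.
Local Open Scope ring_scope.

(** * Amplitudes of truncated orthogonal evolutions *)

Section Realizable.
Variables (R : realFieldType) (Sigma : Type).

Definition step (X : finType) (K : Sigma -> X -> X -> R) (S : pred X)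
    (v : X -> R) (a : Sigma) : X -> R :=
  fun x => if S x then \sum_y K a x y * v y else 0.

Definition run (X : finType) (K : Sigma -> X -> X -> R) (S : pred X) (x0 : X)
    (w : seq Sigma) : X -> R :=
  foldl (step K S) (fun x => (x == x0)%:R) w.

Lemma run_rcons (X : finType) (K : Sigma -> X -> X -> R) S x0 w a :
  run K S x0 (rcons w a) = step K S (run K S x0 w) a.
Proof. by rewrite /run foldl_rcons. Qed.

Definition orthogonal_kernel (X : finType) (K : X -> X -> R) :=
  forall x y, \sum_z K x z * K y z = (x == y)%:R.

(** The amplitudes themselves, not their squares, sum to 1; so replacing [A] by its complement turns
    [f] into [1 - f]. *)
Definition realizable (f : seq Sigma -> R) :=
  exists (X : finType) (K : Sigma -> X -> X -> R) (S A : pred X) (x0 : X),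
    [/\ forall a, orthogonal_kernel (K a),
        forall w, \sum_x run K S x0 w x = 1
      & forall w, f w = \sum_(x | A x) run K S x0 w x].

Lemma eq_realizable f g : f =1 g -> realizable f -> realizable g.
Proof.
move=> fg [X [K [S [A [x0 [KO K1 fE]]]]]].
by exists X, K, S, A, x0; split=> // w; rewrite -fg.
Qed.

Lemma realizable_compl f : realizable f -> realizable (fun w => 1 - f w).
Proof.
move=> [X [K [S [A [x0 [KO K1 fE]]]]]].
exists X, K, S, (predC A), x0; split=> // w.
by rewrite fE -(K1 w) [X in X - _](bigID A) /= addrAC subrr add0r.
Qed.

Lemma realizable_mul f g :
  realizable f -> realizable g -> realizable (fun w => f w * g w).
Proof.
move=> [X [K [S [A [x0 [KO K1 fE]]]]]] [Y [H [T [B [y0 [HO H1 gE]]]]]].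
pose KH a (p q : X * Y) := K a p.1 q.1 * H a p.2 q.2.
pose ST (p : X * Y) := S p.1 && T p.2.
have runE w p : run KH ST (x0, y0) w p = run K S x0 w p.1 * run H T y0 w p.2.
  elim/last_ind: w p => [|w a IHw] [x y] /=.
    by rewrite /run /= xpair_eqE -natrM mulnb.
  rewrite !run_rcons /step /ST /=.
  case: (S x); case: (T y); rewrite ?(mul0r, mulr0) //=.
  rewrite big_distrlr pair_bigA; apply: eq_bigr => -[x' y'] _ /=.
  by rewrite IHw /= mulrACA.
exists (X * Y)%type, KH, ST, (fun p => A p.1 && B p.2), (x0, y0).
split=> [a p q|w|w].
- case: p q => [x y] [x' y']; rewrite xpair_eqE -mulnb natrM -(KO a) -(HO a).
  rewrite big_distrlr pair_bigA; apply: eq_bigr => -[x1 y1] _ /=.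
  by rewrite /KH /= mulrACA.
- rewrite -[RHS]mulr1 -{1}(K1 w) -(H1 w) big_distrlr pair_bigA.
  by apply: eq_bigr => p _; rewrite runE.
- rewrite fE gE big_distrlr pair_big /=.
  by apply: eq_bigr => p _; rewrite runE.
Qed.

Lemma realizable_exp f m : realizable f -> realizable (fun w => f w ^+ m.+1).
Proof.
move=> rf; elim: m => [|m IHm]; first exact: rf.
by apply: eq_realizable (realizable_mul rf IHm) => w; rewrite [RHS]exprS.
Qed.

End Realizable.

(** * Permutations cycling intervals *)

(* The cycles of [shift_perm n p n] are the maximal intervals whose points, except the last one, satisfy [p]; each [i] with [p i] is the image of [i.+1]. *)
Fixpoint shift_perm (n : nat) (p : pred nat) (k : nat) : 'S_n.+1 :=
  if k is k'.+1 then
    (shift_perm n p k' * (if p k' then tperm (inord k') (inord k'.+1) else 1))%g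
  else 1%g.

Lemma shift_permS n (p : pred nat) k (j : 'I_n.+1) : (k < n)%N ->
  let j' := shift_perm n p k j in
  shift_perm n p k.+1 j = (if p k && (j' == k :> nat) then k.+1
    else if p k && (j' == k.+1 :> nat) then k else j') :> nat.
Proof.
move=> kn j'; have hk : (inord k : 'I_n.+1) = k :> nat by rewrite inordK //; lia.
have hk1 : (inord k.+1 : 'I_n.+1) = k.+1 :> nat by rewrite inordK.
rewrite /= permM -/j'; case: (p k); last by rewrite perm1.
by rewrite permE /= -!val_eqE /= hk hk1; do 2![case: ifP => //].
Qed.

(** The factors are transpositions of [i'] and [i'.+1] with [i' < k] and [p i']; none of them
    crosses the cut between [i] and [i.+1]. *)
Lemma shift_perm_le n (p : pred nat) k (i : nat) (j : 'I_n.+1) :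
  (k <= n)%N -> (k <= i)%N || ~~ p i -> (shift_perm n p k j <= i)%N = (j <= i)%N.
Proof.
elim: k => [|k IHk] kn hi; first by rewrite perm1.
rewrite shift_permS // -IHk ?(ltnW kn) //; last first.
  by move: hi => /orP[/ltnW ->|->]; rewrite ?orbT.
have : p k -> k != i.
  by move=> pk; apply: contraL hi => /eqP <-; rewrite ltnn pk.
case: (p k) => [/(_ isT) ki|//] /=.
by case: eqP => [->|_]; [lia|case: eqP => [->|_]; lia].
Qed.

Lemma shift_perm_id n (p : pred nat) k (j : 'I_n.+1) :
  (k < j)%N -> shift_perm n p k j = j.
Proof.
move=> kj; have := ltn_ord j; rewrite ltnS => jn; apply/val_inj => /=.
(* The initial segments up to [j] and up to [j.-1] are both stable, and they differ by [j] alone. *)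
have := @shift_perm_le n p k j j; have := @shift_perm_le n p k j.-1 j.
have -> : (k <= j.-1)%N by lia.
have -> : (k <= j)%N by lia.
have -> : (k <= n)%N by lia.
move=> /(_ isT isT) + /(_ isT isT); lia.
Qed.

(** The factors before the transposition of [i] and [i.+1] fix [j], that one sends [i.+1] to [i],
    and the later ones move only points above [i]. *)
Lemma shift_perm_active n (p : pred nat) k (i : nat) (j : 'I_n.+1) :
  (k <= n)%N -> (i < k)%N -> p i -> (i < j)%N ->
  if j == i.+1 :> nat then shift_perm n p k j = i :> nat
  else (i < shift_perm n p k j)%N.
Proof.
elim: k => // k IHk kn; rewrite ltnS leq_eqVlt => /predU1P[->|ik] pi ij.
  rewrite shift_permS // shift_perm_id // pi /= [j == k :> nat]gtn_eqF //.
  by case: ifP => //; case: ifP.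
have := IHk (ltnW kn) ik pi ij; rewrite shift_permS //.
case: ifP => _; case: (p k) => //=; case: eqP => [->|_]; try lia;
  by case: eqP => [->|_]; lia.
Qed.

(** * Lazy walks detecting a subword *)

Section Atom.
Variables (R : realFieldType) (Sigma : eqType).

Definition active (z : seq Sigma) (a : Sigma) : pred nat :=
  fun i => (i < size z)%N && (nth a z i == a).

Definition advance (z : seq Sigma) (i : nat) (a : Sigma) : nat :=
  if active z a i then i.+1 else i.

(** [advance] matches each letter at its earliest occurrence, which is how [subseq] decides
    embedding. *)
Lemma foldl_advance z w i : (i <= size z)%N ->
  (foldl (advance z) i w == size z) = subseq (drop i z) w.
Proof.
elim: w i => [|a w IHw] i iz.
  rewrite /= -size_eq0 size_drop; lia.
rewrite -[LHS]/(foldl (advance z) (advance z i a) w == size z).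
have [iz'|zi] := ltnP i (size z).
  have -> : advance z i a = if nth a z i == a then i.+1 else i.
    by rewrite /advance /active iz'.
  by rewrite (drop_nth a iz') /=; case: (nth a z i == a); rewrite IHw // -drop_nth.
have -> : advance z i a = i by rewrite /advance /active ltnNge zi.
by rewrite IHw // drop_oversize // !sub0seq.
Qed.

Definition atom_perm (z : seq Sigma) (a : Sigma) : 'S_(size z).+1 :=
  shift_perm (size z) (active z a) (size z).

(** Pulling back along the permutation moves mass upwards: if [i] is active, [i.+1] receives half of
    the mass of its image [i]. *)
Definition lazy_walk (z : seq Sigma) (w : seq Sigma) : 'I_(size z).+1 -> R :=
  foldl (fun v a i => (v i + v (atom_perm z a i)) / 2) (fun i => (i == ord0)%:R) w.
Arguments lazy_walk : clear implicits.

Lemma lazy_walk_rcons z w a i : lazy_walk z (rcons w a) i =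
  (lazy_walk z w i + lazy_walk z w (atom_perm z a i)) / 2.
Proof. by rewrite /lazy_walk foldl_rcons. Qed.

Lemma lazy_walk_sum z w : \sum_i lazy_walk z w i = 1.
Proof.
elim/last_ind: w => [|w a IHw].
  rewrite /lazy_walk /= (bigD1 ord0) //= big1 ?addr0 // => i /negbTE -> //.
under eq_bigr do rewrite lazy_walk_rcons.
rewrite -mulr_suml big_split /= IHw.
have -> : \sum_i lazy_walk z w (atom_perm z a i) = 1.
  by rewrite -IHw [RHS](reindex_inj (@perm_inj _ (atom_perm z a))).
lra.
Qed.

Lemma lazy_walk_bounds z w (m := foldl (advance z) 0 w) :
  (m <= size z)%N /\
  forall i : 'I_(size z).+1,
    if (m < i)%N then lazy_walk z w i = 0 else (1 / 2) ^+ m <= lazy_walk z w i.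
Proof.
rewrite {}/m; elim/last_ind: w => [|w a [IHm IHw]].
  split=> // i; rewrite /lazy_walk /= lt0n -val_eqE /=.
  by case: eqP => //= ->; rewrite ?expr0.
rewrite foldl_rcons; set m := foldl _ _ _ in IHm IHw *.
have w_ge0 i : 0 <= lazy_walk z w i.
  have := IHw i; case: ifP => _; first by move=> ->.
  by apply: le_trans; rewrite exprn_ge0 // divr_ge0.
rewrite /advance; case: ifP => pm; last first.
  (* As [m] is inactive, the permutation preserves {0, ..., m}, so masses are averaged only within
     the support or outside it. *)
  split=> // i; rewrite lazy_walk_rcons.
  have := IHw i; have := IHw (atom_perm z a i).
  rewrite !ltnNge shift_perm_le ?pm ?orbT //; case: (i <= m)%N => /=; lra.
have mz : (m < size z)%N by case/andP: pm.
split=> // i; rewrite lazy_walk_rcons exprS.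
have := w_ge0 (atom_perm z a i); have := IHw i.
have := @shift_perm_active (size z) (active z a) (size z) m i (leqnn _) mz pm.
(* Below [m.+1] at least half of the old mass stays; above it, [i] and its image are both beyond the
   support; at [m.+1], half of the mass of [m] arrives. *)
case: (ltngtP i m.+1) => [im _|im|im] /=; first lra.
  move=> /(_ isT) mW -> _; have := IHw (atom_perm z a i).
  by rewrite mW => ->; rewrite addr0 mul0r.
move=> /(_ isT) mW; have := IHw (atom_perm z a i).
by rewrite mW ltnn => ? -> _; lra.
Qed.

Lemma realizable_atom (z : seq Sigma) : exists2 f : seq Sigma -> R,
  realizable f &
  forall w, if ~~ subseq z w then f w = 0 else (1 / 2) ^+ size z <= f w <= 1.
Proof.
set n := size z; exists (fun w => lazy_walk z w ord_max); last first.
  move=> w; have [mz vm] := lazy_walk_bounds z w.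
  have := @foldl_advance z w 0 (leq0n _); rewrite drop0 => <-.
  have := vm ord_max; rewrite /= [(_ < size z)%N]ltn_neqAle mz andbT.
  case: eqP => [->|//] /= ->; rewrite -(lazy_walk_sum z w) (bigD1 ord_max) //= lerDl.
  apply: sumr_ge0 => i _; have := vm i; case: ifP => _; first by move=> ->.
  by apply: le_trans; rewrite exprn_ge0 // divr_ge0.
(* With respect to the boolean, the blocks of [K a] are (I + V)/2 on the diagonal and (I - V)/2 off it, where V is the matrix of [atom_perm z a]. *)
pose K a (p q : 'I_n.+1 * bool) : R :=
  ((p.1 == q.1)%:R + (-1) ^+ (p.2 (+) q.2) * (atom_perm z a p.1 == q.1)%:R) / 2.
pose S (p : 'I_n.+1 * bool) := ~~ p.2.
have sum_delta (j : 'I_n.+1) (F : 'I_n.+1 -> R) : \sum_i (j == i)%:R * F i = F j.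
  rewrite (bigD1 j) //= eqxx mul1r big1 ?addr0 // => i.
  by rewrite eq_sym => /negbTE ->; rewrite mul0r.
have sum_bool (F : 'I_n.+1 * bool -> R) :
    \sum_q F q = \sum_i (F (i, true) + F (i, false)).
  under [RHS]eq_bigr do rewrite -(big_bool _ (fun b => F (_, b))).
  by rewrite pair_bigA; apply: eq_bigr => -[].
have runE w p : run K S (ord0, false) w p = if p.2 then 0 else lazy_walk z w p.1.
  elim/last_ind: w p => [|w a IHw] [i b] /=.
    by rewrite /run /= xpair_eqE andbC; case: b.
  rewrite run_rcons /step /S /=; case: b => //=.
  transitivity (\sum_j (((i == j)%:R * lazy_walk z w j
      + (atom_perm z a i == j)%:R * lazy_walk z w j) / 2)).
    rewrite sum_bool; apply: eq_bigr => j _; rewrite !IHw /K /= expr0; ring.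
  by rewrite -mulr_suml big_split /= !sum_delta lazy_walk_rcons.
exists ('I_n.+1 * bool)%type, K, S, (pred1 (ord_max, false)), (ord0, false).
split=> [a [i b] [i' b']|w|w] //.
- rewrite sum_bool.
  (* The mixed terms have opposite signs for the two values of the boolean and cancel. *)
  transitivity (\sum_j (((i == j)%:R * (i' == j)%:R
      + (-1) ^+ (b (+) b')
        * ((atom_perm z a i == j)%:R * (atom_perm z a i' == j)%:R)) / 2) : R).
    apply: eq_bigr => j _; rewrite /K /=.
    by case: b; case: b' => /=; rewrite ?expr0 ?expr1; field.
  rewrite -mulr_suml big_split /= -mulr_sumr !sum_delta.
  rewrite (inj_eq perm_inj) xpair_eqE ![i' == i]eq_sym.
  by case: (i == i'); case: b; case: b' => /=; rewrite ?expr0 ?expr1; lra.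
- rewrite sum_bool -(lazy_walk_sum z w); apply: eq_bigr => j _.
  by rewrite !runE /= add0r.
- by rewrite big_pred1_eq runE.
Qed.

End Atom.

(** * Uniform approximation of Boolean combinations *)

Section Approximable.
Variables (R : realType) (Sigma : eqType).

Lemma exp_small (c e : R) : 0 <= c < 1 -> 0 < e -> exists m, c ^+ m <= e.
Proof.
move=> /andP[c0 c1] e0.
(* A form of Bernoulli's inequality, making [c ^+ m] at most the inverse of [m%:R * (1 - c)]. *)
have bern m : c ^+ m * (1 + m%:R * (1 - c)) <= 1.
  elim: m => [|m IHm]; first by rewrite expr0; lra.
  apply: le_trans IHm; rewrite exprSr -mulrA ler_wpM2l ?exprn_ge0 //.
  have sq := sqr_ge0 (1 - c); have := mulr_ge0 (ler0n R m) sq.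
  by rewrite -natr1; nra.
have ed0 : 0 < e * (1 - c) by rewrite mulr_gt0 ?subr_gt0.
have [m hm] : exists m : nat, (e * (1 - c))^-1 <= m%:R.
  exists (Num.bound (e * (1 - c))^-1); apply/ltW/archi_boundP.
  by rewrite invr_ge0 ltW.
exists m; move: hm; rewrite -div1r ler_pdivrMr // => hm.
have := bern m; have := exprn_ge0 m c0; nra.
Qed.

Definition approximable (b : pred (seq Sigma)) :=
  forall e : R, 0 < e -> exists2 f, realizable f &
    forall w, 0 <= f w <= 1 /\ (if b w then 1 - e <= f w else f w <= e).

Lemma approximable_compl b : approximable b -> approximable (predC b).
Proof.
move=> ab e e0; have [f rf fP] := ab e e0.
exists (fun w => 1 - f w) => [|w]; first exact: realizable_compl.
by have [/andP[? ?]] := fP w; rewrite /=; case: (b w) => /= ?; split; lra.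
Qed.

Lemma approximable_inter b c :
  approximable b -> approximable c -> approximable (predI b c).
Proof.
(* The errors add up: f g >= f + g - 1 for f, g in [0, 1], and f g is at most either factor. *)
move=> ab ac e e0; have e2 : 0 < e / 2 by lra.
have [f rf fP] := ab _ e2; have [g rg gP] := ac _ e2.
exists (fun w => f w * g w) => [|w]; first exact: realizable_mul.
have [/andP[f0 f1] fb] := fP w; have [/andP[g0 g1] gc] := gP w.
split; first by apply/andP; split; nra.
by rewrite /=; move: fb gc; case: (b w); case: (c w) => /= *; nra.
Qed.

Lemma approximable_atom z : approximable (subseq z).
Proof.
move=> e e0; have [f rf fP] := realizable_atom R z.
have d0 : 0 < (1 / 2 : R) ^+ size z by rewrite exprn_gt0 // divr_gt0.
have d1 : (1 / 2 : R) ^+ size z <= 1 by rewrite exprn_ile1 //; lra.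
have [m hm] : exists m, (1 - (1 / 2) ^+ size z) ^+ m <= e :> R.
  by apply: exp_small => //; lra.
(* [realizable_exp] provides positive powers only; the extra factor [1 - f w] is at most 1. *)
exists (fun w => 1 - (1 - f w) ^+ m.+1) => [|w].
  exact/realizable_compl/realizable_exp/realizable_compl.
have := fP w; case: (subseq z w) => /= [/andP[f0 f1]|->]; last first.
  by rewrite subr0 expr1n; lra.
have h0 : 0 <= 1 - f w by lra.
have h1 : (1 - f w) ^+ m.+1 <= e.
  apply: le_trans hm; rewrite exprS -[leRHS]mul1r ler_pM ?exprn_ge0 //; first lra.
  by rewrite lerXn2r // ?nnegrE; lra.
have := exprn_ge0 m.+1 h0; have : (1 - f w) ^+ m.+1 <= 1 by rewrite exprn_ile1 //; lra.
lra.
Qed.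

Lemma in_shuffle_idealP (z w : seq Sigma) : reflect (in_shuffle_ideal z w) (subseq z w).
Proof.
apply: (iffP idP).
  elim: z w => [//|a z IHz] w /=.
  elim: w => [//|b w IHw] /=; case: eqP => [<-|_] h; first by exists [::], w; auto.
  by have [u [v [-> hv]]] := IHw h; exists (b :: u), v.
elim: z w => [|a z IHz] w /=; first by rewrite sub0seq.
move=> [u [v [-> /IHz zv]]]; apply: subseq_trans (suffix_subseq u _).
by rewrite /= eqxx.
Qed.

(** Membership is tracked by a boolean, so that unions reduce to complements and intersections by De
    Morgan. *)
Lemma approximable_pt_sem (e : pt_expr Sigma) : exists2 b : pred (seq Sigma),
  forall w, pt_sem e w <-> b w & approximable b.
Proof.
elim: e => [z|e1 [b1 h1 a1] e2 [b2 h2 a2]|e1 [b1 h1 a1] e2 [b2 h2 a2]|e [b h a]] /=.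
- exists (subseq z); last exact: approximable_atom.
  by move=> w; exact: rwP (in_shuffle_idealP z w).
- exists (predC (predI (predC b1) (predC b2))) => [w|].
    by rewrite h1 h2 /= negb_and !negbK; exact: rwP orP.
  by do ![apply: approximable_compl|apply: approximable_inter].
- exists (predI b1 b2) => [w|]; last exact: approximable_inter.
  by rewrite h1 h2 /=; exact: rwP andP.
- exists (predC b) => [w|]; last exact: approximable_compl.
  by rewrite h /=; exact: rwP negP.
Qed.

End Approximable.

(** * The automaton and its acceptance probability *)

Section Machine.
Variables (R : realType) (Sigma : finType).
Variables (X : finType) (K : Sigma -> X -> X -> R) (S A : pred X) (x0 : X).
Hypothesis KO : forall a, orthogonal_kernel (K a).

Local Notation m := #|X|.
Local Notation RtoC := (@real_complex R).
Local Notation c := (#|A|%:R^-1 : R).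

Let kernel_mx (k : X -> X -> R) : 'M[R]_m := \matrix_(i, j) k (enum_val i) (enum_val j).

Let project_A : 'M[R]_m := kernel_mx (fun x y => c * (A x && A y)%:R).

(* The second block of coordinates collects the accepting states; the end-marker applies the unitary dilation of the projection onto the line spanned by the indicator of [A]. *)
Definition machine_matrix (s : option Sigma) : 'M[R]_(m + m) :=
  if s is Some a then block_mx (kernel_mx (K a)) 0 0 1%:M
  else block_mx (1%:M - project_A) project_A project_A (1%:M - project_A).

(** Rejecting the first-block coordinates outside [S] performs the truncation of [step]. *)
Definition machine : mmqfa R Sigma :=
  @MMQFA R Sigma (m + m) (fun s => map_mx RtoC (machine_matrix s))
    (lshift m (enum_rank x0))
    [set i | if split i is inr _ then true else false]
    [set i | if split i is inl j then ~~ S (enum_val j) else false].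

Lemma sum_enum_val (F : X -> R) : \sum_(j < m) F (enum_val j) = \sum_x F x.
Proof. by rewrite [RHS](reindex _ (onW_bij _ (@enum_val_bij X))). Qed.

Lemma project_AK : project_A *m project_A = project_A.
Proof.
apply/matrixP => i j; rewrite !mxE; under eq_bigr do rewrite !mxE.
rewrite (sum_enum_val (fun x =>
  c * (A (enum_val i) && A x)%:R * (c * (A x && A (enum_val j))%:R))).
rewrite (bigID A) /= [X in _ + X]big1 ?addr0; last first.
  by move=> x /negbTE ->; rewrite andbF mulr0 mul0r.
under eq_bigr => x -> do rewrite andbT /=.
rewrite sumr_const; case: (A _); case: (A _) => /=; rewrite ?(mulr0, mul0r, mul0rn) //.
rewrite !mulr1 -[c * c *+ _]mulr_natr -mulrA.
(* For empty [A] the inverse of 0 is 0, and the projection is zero. *)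
have [->|nz] := eqVneq (#|A|%:R : R) 0; first by rewrite invr0 !mul0r.
by rewrite mulVf ?mulr1.
Qed.

(** For the end-marker, P = [project_A] is symmetric and idempotent, whence (1 - P)^2 + P^2 = 1 and
    (1 - P) P = 0. *)
Lemma machine_matrix_orth s : machine_matrix s *m (machine_matrix s)^T = 1%:M.
Proof.
have pT : project_A^T = project_A.
  by apply/matrixP => i j; rewrite !mxE andbC.
case: s => [a|]; rewrite /machine_matrix tr_block_mx mulmx_block.
  rewrite !(trmx0, trmx1, mulmx0, mul0mx, addr0, add0r, mulmx1) scalar_mx_block.
  congr block_mx; apply/matrixP => i j; rewrite !mxE; under eq_bigr do rewrite !mxE.
  rewrite (sum_enum_val (fun x => K a (enum_val i) x * K a (enum_val j) x)) KO.
  by rewrite (inj_eq enum_val_inj).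
rewrite !linearB /= !trmx1 pT scalar_mx_block.
rewrite !(mulmxBl, mulmxBr, mul1mx, mulmx1) !project_AK.
by rewrite subrr subr0 addr0 subrK addrCA subrr addr0.
Qed.

Lemma machine_wf : well_formed machine.
Proof.
split=> [|s].
  rewrite -setI_eq0; apply/eqP/setP => i; rewrite !inE /=.
  by case: (split i) => ?; rewrite ?andbF.
have conjE : map_mx Num.conj (mm_U machine s) = map_mx RtoC (machine_matrix s).
  by apply/matrixP => i j; rewrite !mxE /=; exact: conjc_real.
have UU : mm_U machine s *m (map_mx Num.conj (mm_U machine s))^T = 1%:M.
  by rewrite conjE map_trmx -map_mxM machine_matrix_orth map_mx1.
by split=> //; exact: mulmx1C.
Qed.

Lemma mul_proj n (T : {set 'I_n}) (v : 'cV[R[i]]_n) :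
  proj R T *m v = \col_i (if i \in T then v i 0 else 0).
Proof.
apply/matrixP => i j; rewrite ord1 !mxE (bigD1 i) //= big1 ?addr0 => [|k ki].
  by rewrite mxE eqxx /=; case: ifP; rewrite ?mul1r ?mul0r.
by rewrite mxE eq_sym (negbTE ki) mul0r.
Qed.

Let runv w : 'cV[R]_m := \col_j run K S x0 w (enum_val j).

Lemma mul_machine_Some w a :
  map_mx RtoC (machine_matrix (Some a)) *m map_mx RtoC (col_mx (runv w) 0) =
  map_mx RtoC (col_mx (kernel_mx (K a) *m runv w) 0).
Proof. by rewrite -map_mxM mul_block_col !(mul0mx, mulmx0, addr0). Qed.

(** Letters act as the identity on the second block, which starts at zero and remains so. *)
Lemma state_afterE w : state_after machine w = map_mx RtoC (col_mx (runv w) 0).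
Proof.
rewrite /state_after /mm_run; elim/last_ind: w => [|w a IHw].
  apply/matrixP => i j; rewrite !mxE /=; case: (split_ordP i) => k ->.
    rewrite (inj_eq (@lshift_inj _ _)) !mxE /= -(inj_eq enum_val_inj) enum_rankK.
    by rewrite /run /=; case: eqP => _; rewrite ?rmorph1 ?rmorph0.
  by rewrite eq_rlshift mxE rmorph0.
rewrite map_rcons foldl_rcons; move: IHw.
case: (foldl _ _ _) => [[psi pa] pr] /= ->.
rewrite mul_machine_Some /P_non mul_proj; apply/matrixP => i j; rewrite !mxE !inE /=.
case: (split_ordP i) => k _ /=; last by rewrite mxE.
rewrite ord1 !mxE run_rcons /step negbK; case: (S _) => //; congr RtoC.
under eq_bigr do rewrite !mxE.
by rewrite (sum_enum_val (fun x => K a (enum_val k) x * run K S x0 w x)).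
Qed.

Lemma machine_end_decisive : end_decisive machine.
Proof.
move=> w a; rewrite state_afterE mul_machine_Some /P_acc mul_proj.
apply/matrixP => i j; rewrite !mxE !inE /=.
by case: (split_ordP i) => k _ //=; rewrite mxE rmorph0.
Qed.

Lemma machine_acc w : (mm_run machine (map Some w)).1.2 = 0.
Proof.
elim/last_ind: w => [//|w a IHw].
have := machine_end_decisive w a; rewrite /state_after /mm_run map_rcons foldl_rcons.
move: IHw; rewrite /mm_run; case: (foldl _ _ _) => [[psi pa] pr] /= -> ->.
by rewrite add0r /norm2 big1 // => i _; rewrite mxE normr0 expr0n.
Qed.

(** The end-marker puts c f times the indicator of [A] into the second block, where f is the mass of
    [A]; its squared norm is c^2 f^2 #|A| = c f^2. *)
Lemma accept_probE w :
  accept_prob machine w = RtoC (c * (\sum_(x | A x) run K S x0 w x) ^+ 2).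
Proof.
have := machine_acc w; have := state_afterE w.
rewrite /accept_prob /state_after /mm_run foldl_rcons.
case: (foldl _ _ _) => [[psi pa] pr] /= -> ->; rewrite add0r.
rewrite -map_mxM mul_block_col !mulmx0 !addr0 /P_acc mul_proj /norm2 big_split_ord /=.
rewrite big1 ?add0r => [|i _]; last first.
  by rewrite !mxE !inE /= (unsplitK (inl _)) normr0 expr0n.
set f := \sum_(x | A x) _.
have sumE (i : 'I_m) : (project_A *m runv w) i 0 = c * (A (enum_val i))%:R * f.
  rewrite mxE; under eq_bigr do rewrite !mxE.
  rewrite (sum_enum_val (fun x => c * (A (enum_val i) && A x)%:R * run K S x0 w x)).
  rewrite /f mulr_sumr [RHS]big_mkcond; apply: eq_bigr => x _.
  by case: (A x); rewrite ?andbT // andbF mulr0 mul0r.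
transitivity (\sum_(i < m) RtoC ((c * f) ^+ 2 * (A (enum_val i))%:R)).
  apply: eq_bigr => i _; rewrite !mxE !inE /= (unsplitK (inr _)) /=.
  rewrite sqr_normc conjc_real -rmorphM; congr RtoC.
  have := sumE i; rewrite mxE => ->.
  by case: (A _); rewrite ?(mulr0, mulr1, mul0r) -?expr2.
rewrite -rmorph_sum; congr RtoC.
rewrite -mulr_sumr (sum_enum_val (fun x => (A x)%:R)) -natr_sum.
have -> : (\sum_x A x)%N = #|A| by rewrite -sum1_card [RHS]big_mkcond.
have [->|nz] := eqVneq (#|A|%:R : R) 0; first by rewrite invr0 !mul0r mulr0.
by field.
Qed.

End Machine.

Theorem theorem4p15 (R : realType) (Sigma : finType) (L : seq Sigma -> Prop) :
  piecewise_testable L ->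
  exists M : mmqfa R Sigma,
    well_formed M /\ end_decisive M /\ accepts_bounded M L.
Proof.
move=> [e Le]; have [b be /(_ (1 / 4))[]] := approximable_pt_sem R e; first lra.
move=> f [X [K [S [A [x0 [KO _ fE]]]]]] fP.
exists (machine K S A x0); split; [exact: machine_wf|split].
  exact: machine_end_decisive.
rewrite /accepts_bounded; set c : R := #|A|%:R^-1.
have c_ge0 : 0 <= c by rewrite invr_ge0 ler0n.
(* If [A] is empty, then [f] vanishes, hence so does [L]. *)
have [c0|c_neq0] := eqVneq c 0.
  exists 1, (1 / 2); split; first lra.
  move=> x; rewrite accept_probE -fE -/c c0 mul0r; split=> [Lx|_]; last by rewrite ltcR; lra.
  have [_] := fP x; have /be -> := (Le x).1 Lx.
  rewrite fE big_pred0 => [?|y]; first by exfalso; lra.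
  by move/eqP: c0; rewrite invr_eq0 pnatr_eq0 => /eqP/card0_eq/(_ y).
have c_gt0 : 0 < c by rewrite lt_neqAle eq_sym c_neq0.
(* With error 1/4, c f^2 is at least 9c/16 on [L] and at most c/16 off it; 5c/16 is the midpoint,
   and c/8 is half of the distance c/4 to either value, giving strict bounds. *)
exists (5 / 16 * c), (1 / 8 * c); split; first by nra.
move=> x; rewrite accept_probE // -fE -/c !ltcR.
have [/andP[f0 f1]] := fP x.
have := be x; have := Le x; case: (b x) => h1 h2 hf; split=> h.
- by rewrite -mulrDl mulrC ltr_pM2l //; nra.
- by case: h; apply/h1/h2.
- by have := h2.1 (h1.1 h).
- by rewrite -mulrBl [ltRHS]mulrC ltr_pM2l //; nra.
Qed.
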